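(* Let $C_0>0$ be a constant and consider the surface $(\mathbb{R}^2,g_{C_0})$, where $g_{C_0}=C_0(\cosh u)^6(du^2+dv^2)$, with Gaussian curvature $K_{C_0}$. Then $\left(\mathbb{R}^2,\sqrt{-K_{C_0}}\,g_{C_0}\right)$ is complete, satisfies the Ricci condition, and can be minimally immersed in $\mathbb{R}^3$ as a helicoid or a catenoid.
   Context: The Gaussian curvature of $(\mathbb{R}^2,g_{C_0})$ is $K_{C_0}(u,v)=-\dfrac{3}{C_0(\cosh u)^8}<0$. A Riemannian surface $(M^2,g)$ with Gaussian curvature $K$ satisfies the Ricci condition (with respect to $c=0$, the case relevant for $\mathbb{R}^3$) if $K<0$ and $$-K\Delta K-|\operatorname{grad}K|^2-4K^3=0,$$ where $\Delta=-\operatorname{div}\operatorname{grad}$ is the Laplace–Beltrami operator of $g$ (the paper's sign convention) and all quantities are computed with respect to $g$; here the condition is applied to the metric $\sqrt{-K_{C_0}}\,g_{C_0}$ and to its own Gaussian curvature. ''Can be minimally immersed in $\mathbb{R}^3$ as a helicoid or a catenoid'' means that there is an isometric minimal immersion of the surface into $\mathbb{R}^3$ whose image is a helicoid, and also one whose image is a catenoid. *)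

(* Defs.v *)
From Stdlib Require Import Reals.
From Coquelicot Require Import Coquelicot.
Open Scope R_scope.

Inductive idx : Set := iu | iv.

Definition sum2 (f : idx -> R) : R := f iu + f iv.

Definition coord (i : idx) (p : R * R) : R :=
  match i with iu => fst p | iv => snd p end.

Definition subst_coord (i : idx) (p : R * R) (t : R) : R * R :=
  match i with iu => (t, snd p) | iv => (fst p, t) end.

Definition ex_pd (i : idx) (f : R * R -> R) (p : R * R) : Prop :=
  ex_derive (fun t => f (subst_coord i p t)) (coord i p).

Definition pd (i : idx) (f : R * R -> R) (p : R * R) : R :=
  Derive (fun t => f (subst_coord i p t)) (coord i p).

Fixpoint Ck (n : nat) (f : R * R -> R) : Prop :=
  (forall p, continuous f p) /\
  match n with
  | O => True
  | S m => forall i, (forall p, ex_pd i f p) /\ Ck m (pd i f)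
  end.

Definition smooth (f : R * R -> R) : Prop := forall n, Ck n f.

(* [g i j p] is the coefficient g_ij at [p]. *)
Definition metric : Type := idx -> idx -> R * R -> R.

Definition riemannian (g : metric) : Prop :=
  (forall i j, smooth (g i j)) /\
  (forall i j p, g i j p = g j i p) /\
  (forall p (x : idx -> R), (exists i, x i <> 0) ->
     0 < sum2 (fun i => sum2 (fun j => g i j p * x i * x j))).

Definition conformal (f : R * R -> R) (g : metric) : metric :=
  fun i j p => f p * g i j p.

Definition euclidean : metric :=
  fun i j _ =>
    match i, j with iu, iu | iv, iv => 1 | _, _ => 0 end.

Definition det (g : metric) (p : R * R) : R :=
  g iu iu p * g iv iv p - g iu iv p * g iv iu p.

Definition inv (g : metric) (i j : idx) (p : R * R) : R :=
  match i, j with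
  | iu, iu => g iv iv p / det g p
  | iv, iv => g iu iu p / det g p
  | iu, iv => - g iu iv p / det g p
  | iv, iu => - g iv iu p / det g p
  end.

(* Gamma^k_ij of the Levi-Civita connection. *)
Definition christoffel (g : metric) (k i j : idx) (p : R * R) : R :=
  / 2 * sum2 (fun l => inv g k l p *
    (pd i (g j l) p + pd j (g i l) p - pd l (g i j) p)).

(* The [l]-th component of R(d_i, d_j) d_k, with the sign convention
   R(X, Y) = [nabla_X, nabla_Y] - nabla_[X, Y]. *)
Definition riemann (g : metric) (l i j k : idx) (p : R * R) : R :=
  pd i (christoffel g l j k) p - pd j (christoffel g l i k) p
  + sum2 (fun m => christoffel g l i m p * christoffel g m j k p
                   - christoffel g l j m p * christoffel g m i k p).

(* <R(d_u, d_v) d_v, d_u> / det g. *)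
Definition gauss_curvature (g : metric) (p : R * R) : R :=
  sum2 (fun l => g iu l p * riemann g l iu iv iv p) / det g p.

Definition grad (g : metric) (f : R * R -> R) (i : idx) (p : R * R) : R :=
  sum2 (fun j => inv g i j p * pd j f p).

Definition norm_sq (g : metric) (X : idx -> R * R -> R) (p : R * R) : R :=
  sum2 (fun i => sum2 (fun j => g i j p * X i p * X j p)).

Definition div (g : metric) (X : idx -> R * R -> R) (p : R * R) : R :=
  / sqrt (det g p) * sum2 (fun i => pd i (fun q => sqrt (det g q) * X i q) p).

(* Sign convention: Delta = - div grad. *)
Definition laplace (g : metric) (f : R * R -> R) (p : R * R) : R :=
  - div g (grad g f) p.

Definition ricci_condition (g : metric) : Prop :=
  let K := gauss_curvature g in
  forall p, K p < 0 /\
    - K p * laplace g K p - norm_sq g (grad g K) p - 4 * K p ^ 3 = 0.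

(* A C^1 curve on [0, 1] extends to a C^1 curve on the whole line, so curves
   are taken on the line and measured on [0, 1]. *)
Definition C1_curve (c : R -> R * R) : Prop :=
  forall i t, ex_derive (fun s => coord i (c s)) t /\
              continuous (Derive (fun s => coord i (c s))) t.

Definition length (g : metric) (c : R -> R * R) : R :=
  RInt (fun t => sqrt (sum2 (fun i => sum2 (fun j =>
    g i j (c t) * Derive (fun s => coord i (c s)) t
                * Derive (fun s => coord j (c s)) t)))) 0 1.

(* [pw_C1_length g p q l]: some piecewise C^1 curve (a finite concatenation of
   C^1 curves) from [p] to [q] has length [l]. *)
Inductive pw_C1_length (g : metric) : R * R -> R * R -> R -> Prop :=
| pw_nil p : pw_C1_length g p p 0
| pw_cons c q l :
    C1_curve c -> pw_C1_length g (c 1) q l ->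
    pw_C1_length g (c 0) q (length g c + l).

(* The infimum is over a nonempty set of nonnegative reals, hence finite. *)
Definition dist (g : metric) (p q : R * R) : R :=
  real (Glb_Rbar (pw_C1_length g p q)).

Definition complete (g : metric) : Prop :=
  forall s : nat -> R * R,
    (forall eps, 0 < eps -> exists N : nat, forall m n : nat,
       (N <= m)%nat -> (N <= n)%nat -> dist g (s m) (s n) < eps) ->
    exists p, forall eps, 0 < eps -> exists N : nat, forall n : nat,
       (N <= n)%nat -> dist g (s n) p < eps.

Definition vec3 : Type := (R * R * R)%type.

Definition dot (a b : vec3) : R :=
  let '(a1, a2, a3) := a in let '(b1, b2, b3) := b in
  a1 * b1 + a2 * b2 + a3 * b3.

Definition cross (a b : vec3) : vec3 :=
  let '(a1, a2, a3) := a in let '(b1, b2, b3) := b in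
  (a2 * b3 - a3 * b2, a3 * b1 - a1 * b3, a1 * b2 - a2 * b1).

Definition scale3 (k : R) (a : vec3) : vec3 :=
  let '(a1, a2, a3) := a in (k * a1, k * a2, k * a3).

Definition minus3 (a b : vec3) : vec3 :=
  let '(a1, a2, a3) := a in let '(b1, b2, b3) := b in
  (a1 - b1, a2 - b2, a3 - b3).

Definition norm3 (a : vec3) : R := sqrt (dot a a).

Definition smooth3 (X : R * R -> vec3) : Prop :=
  smooth (fun p => fst (fst (X p))) /\
  smooth (fun p => snd (fst (X p))) /\
  smooth (fun p => snd (X p)).

Definition pd3 (i : idx) (X : R * R -> vec3) (p : R * R) : vec3 :=
  (pd i (fun q => fst (fst (X q))) p,
   pd i (fun q => snd (fst (X q))) p,
   pd i (fun q => snd (X q)) p).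

(* Smoothness and injectivity of the differential: the two tangent vectors are
   linearly independent. *)
Definition immersion (X : R * R -> vec3) : Prop :=
  smooth3 X /\ forall p, cross (pd3 iu X p) (pd3 iv X p) <> (0, 0, 0).

Definition first_form (X : R * R -> vec3) : metric :=
  fun i j p => dot (pd3 i X p) (pd3 j X p).

Definition isometric (g : metric) (X : R * R -> vec3) : Prop :=
  forall i j p, first_form X i j p = g i j p.

Definition unit_normal (X : R * R -> vec3) (p : R * R) : vec3 :=
  let n := cross (pd3 iu X p) (pd3 iv X p) in scale3 (/ norm3 n) n.

Definition second_form (X : R * R -> vec3) (i j : idx) (p : R * R) : R :=
  dot (pd3 i (pd3 j X) p) (unit_normal X p).

Definition mean_curvature (X : R * R -> vec3) (p : R * R) : R :=
  / 2 * sum2 (fun i => sum2 (fun j =>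
    inv (first_form X) i j p * second_form X i j p)).

Definition isometric_minimal_immersion (g : metric) (X : R * R -> vec3) : Prop :=
  immersion X /\ isometric g X /\ forall p, mean_curvature X p = 0.

Definition isometry3 (phi : vec3 -> vec3) : Prop :=
  forall a b, norm3 (minus3 (phi a) (phi b)) = norm3 (minus3 a b).

Definition image (X : R * R -> vec3) (q : vec3) : Prop := exists p, X p = q.

Definition std_helicoid (c : R) : vec3 -> Prop :=
  image (fun st => (fst st * cos (snd st), fst st * sin (snd st), c * snd st)).

Definition std_catenoid (c : R) : vec3 -> Prop :=
  image (fun wt => (c * cosh (fst wt / c) * cos (snd wt),
                    c * cosh (fst wt / c) * sin (snd wt), fst wt)).

Definition congruent (S T : vec3 -> Prop) : Prop :=
  exists phi, isometry3 phi /\ forall q, T q <-> exists a, S a /\ phi a = q.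

Definition is_helicoid (S : vec3 -> Prop) : Prop :=
  exists c, c <> 0 /\ congruent (std_helicoid c) S.

Definition is_catenoid (S : vec3 -> Prop) : Prop :=
  exists c, 0 < c /\ congruent (std_catenoid c) S.

Definition cosh_metric (C0 : R) : metric :=
  conformal (fun p => C0 * cosh (fst p) ^ 6) euclidean.

(* [sqrt (- K) g], with [K] the Gaussian curvature of [g]. *)
Definition curvature_rescaled (g : metric) : metric :=
  conformal (fun p => sqrt (- gauss_curvature g p)) g.

(* Main.v *)
Require Import Defs.
From Stdlib Require Import Reals Lra Lia FunctionalExtensionality.
From Coquelicot Require Import Coquelicot.
Open Scope R_scope.

(** The curvature of a metric h(u) (du^2 + dv^2) is - (log h)'' / (2 h).  For
    h = C0 cosh^6 u this is K = - 3 / (C0 cosh^8 u), so the factor sqrt (- K)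
    turns C0 cosh^6 u into A cosh^2 u with A = sqrt (3 C0)
    ([curvature_rescaled_cosh_metric]), and A cosh^2 u (du^2 + dv^2) is the
    metric of the catenoid and of the helicoid of parameter c = sqrt A.

    The coordinates (u, v) are isothermal, so the Christoffel symbols, the
    gradient and the Laplacian of a function of u are elementary expressions
    in one variable.  The curvature is now - 1 / (A cosh^4 u), and the Ricci
    condition is an identity between rational functions of cosh u and sinh u
    ([ricci_condition_cosh2]).

    Since cosh >= 1, the metric dominates A times the Euclidean one.  Hence a
    Cauchy sequence for its distance is Cauchy in each coordinate and converges
    in the plane; near the limit the metric is bounded, so straight segments
    show that the sequence converges for the distance of the metric too
    ([complete_of_ge_euclidean]).

    Finally
      (c cosh u cos v, c cosh u sin v, c u) and
      (c sinh u cos v, c sinh u sin v, c v)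
    both have first fundamental form c^2 cosh^2 u (du^2 + dv^2) and harmonic
    coordinate functions; an isometric immersion in isothermal coordinates with
    harmonic coordinate functions is minimal ([isometric_minimal_of_harmonic]).
    Rescaling u carries the first map to the standard parametrization of a
    catenoid, and sinh being onto carries the second to that of a helicoid. *)

(** * Smooth functions on the plane *)

(** Smoothness of infinite order is coinductive in nature: it follows from
    membership in any class of continuous functions closed under partial
    derivatives. *)
Lemma smooth_of_stable (S : (R * R -> R) -> Prop) :
  (forall f, S f -> (forall p, continuous f p) /\
     forall i, (forall p, ex_pd i f p) /\ S (pd i f)) ->
  forall f, S f -> smooth f.
Proof.
  intros HS f Hf n; revert f Hf.
  induction n as [|n IH]; intros f Hf; destruct (HS f Hf) as [Hc Hd]; simpl.
  - tauto.
  - split; [exact Hc|intros i; destruct (Hd i); auto].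
Qed.

(** A class closed under partial derivatives that contains every coefficient
    and every coordinate function needed below.  Products force sums in, by the
    Leibniz rule. *)
Inductive elementary : (R * R -> R) -> Prop :=
| el_const c : elementary (fun _ => c)
| el_coord i : elementary (coord i)
| el_cosh i : elementary (fun p => cosh (coord i p))
| el_sinh i : elementary (fun p => sinh (coord i p))
| el_cos i : elementary (fun p => cos (coord i p))
| el_sin i : elementary (fun p => sin (coord i p))
| el_plus f g : elementary f -> elementary g -> elementary (fun p => f p + g p)
| el_mult f g : elementary f -> elementary g -> elementary (fun p => f p * g p).

Lemma continuous_coord i p : continuous (coord i) p.
Proof.
  destruct i; [exact (continuous_fst (fst p) (snd p))
              |exact (continuous_snd (fst p) (snd p))].
Qed.

Lemma continuous_along_coord (phi : R -> R) i p :
  ex_derive phi (coord i p) -> continuous (fun q => phi (coord i q)) p.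
Proof.
  intros H. apply (continuous_comp (coord i) phi).
  - apply continuous_coord.
  - exact (ex_derive_continuous phi _ H).
Qed.

Lemma subst_coord_self i p : subst_coord i p (coord i p) = p.
Proof. now destruct p, i. Qed.

Lemma elementary_continuous f : elementary f -> forall p, continuous f p.
Proof.
  intros H; induction H; intros p.
  - apply continuous_const.
  - apply continuous_coord.
  - apply (continuous_along_coord cosh). now auto_derive.
  - apply (continuous_along_coord sinh). now auto_derive.
  - apply (continuous_along_coord cos). now auto_derive.
  - apply (continuous_along_coord sin). now auto_derive.
  - now apply (continuous_plus f g).
  - now apply (continuous_mult f g).
Qed.

Definition delta (i j : idx) : R :=
  match i, j with iu, iu | iv, iv => 1 | _, _ => 0 end.

Lemma is_derive_along_coord (phi : R -> R) i j p l :
  is_derive phi (coord j p) l ->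
  is_derive (fun t => phi (coord j (subst_coord i p t))) (coord i p)
    (delta i j * l).
Proof.
  intros H; destruct i, j; simpl in *;
    rewrite ?Rmult_1_l, ?Rmult_0_l; try exact H; apply @is_derive_const.
Qed.

Lemma elementary_derive f : elementary f -> forall i,
  exists f', elementary f' /\
    forall p, is_derive (fun t => f (subst_coord i p t)) (coord i p) (f' p).
Proof.
  intros H i; induction H as [c|j|j|j|j|j|f g Hf [f' [Ef Df]] Hg [g' [Eg Dg]]
                             |f g Hf [f' [Ef Df]] Hg [g' [Eg Dg]]].
  - exists (fun _ => 0); split; [constructor|intros p; apply @is_derive_const].
  - exists (fun p => delta i j * 1); split; [repeat constructor|intros p].
    apply (is_derive_along_coord (fun x => x)). apply @is_derive_id.
  - exists (fun p => delta i j * sinh (coord j p));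
      split; [repeat constructor|intros p].
    apply is_derive_along_coord. auto_derive; auto; ring.
  - exists (fun p => delta i j * cosh (coord j p));
      split; [repeat constructor|intros p].
    apply is_derive_along_coord. auto_derive; auto; ring.
  - exists (fun p => delta i j * (-1 * sin (coord j p)));
      split; [repeat constructor|intros p].
    apply is_derive_along_coord. auto_derive; auto; ring.
  - exists (fun p => delta i j * cos (coord j p));
      split; [repeat constructor|intros p].
    apply is_derive_along_coord. auto_derive; auto; ring.
  - exists (fun p => f' p + g' p); split; [now constructor|intros p].
    exact (is_derive_plus _ _ _ _ _ (Df p) (Dg p)).
  - exists (fun p => f' p * g p + f p * g' p); split.
    { now repeat constructor. }
    intros p.
    (* The product rule yields the undifferentiated factors at the substituted
       point. *)
    rewrite <- (subst_coord_self i p) at 3 4.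
    exact (is_derive_mult _ _ _ _ _ (Df p) (Dg p) Rmult_comm).
Qed.

Lemma smooth_elementary f : elementary f -> smooth f.
Proof.
  apply (smooth_of_stable elementary); clear f.
  intros f Hf; split; [now apply elementary_continuous|intros i].
  destruct (elementary_derive f Hf i) as [f' [Ef Df]]; split.
  - intros p; eexists; apply Df.
  - replace (pd i f) with f'; [exact Ef|].
    apply functional_extensionality; intros p; symmetry.
    apply is_derive_unique, Df.
Qed.

(** * Metrics with conformal factor depending on u *)

Lemma cosh_pos x : 0 < cosh x.
Proof. unfold cosh; generalize (exp_pos x) (exp_pos (- x)); lra. Qed.

Lemma cosh_sq x : cosh x ^ 2 = 1 + sinh x ^ 2.
Proof.
  assert (H : exp x * exp (- x) = 1)
    by (rewrite <- exp_plus, Rplus_opp_r; apply exp_0).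
  unfold cosh, sinh; nra.
Qed.

(** Both metrics of interest are invariant under translations of [v], which
    reduces their geometry to calculus in the single variable [u]. *)
Definition isothermal (h : R -> R) : metric :=
  conformal (fun p => h (fst p)) euclidean.

Lemma riemannian_isothermal h :
  smooth (fun p => h (fst p)) -> (forall x, 0 < h x) ->
  riemannian (isothermal h).
Proof.
  intros Sh Hh; repeat split.
  - intros i j.
    assert (S0 : smooth (fun _ => 0)) by apply smooth_elementary, el_const.
    replace (isothermal h i j) with
      (match i, j with iu, iu | iv, iv => fun p => h (fst p)
       | _, _ => fun _ : R * R => 0 end).
    + destruct i, j; assumption.
    + apply functional_extensionality; intros p.
      unfold isothermal, conformal; destruct i, j; simpl; ring.
  - intros i j p; now destruct i, j.
  - intros p x Hx; unfold isothermal, conformal, sum2; simpl.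
    assert (0 < x iu * x iu + x iv * x iv).
    { destruct Hx as [[] Hx]; nra. }
    specialize (Hh (fst p)); nra.
Qed.

Lemma pd_fst i (F F' : R -> R) p : (forall x, is_derive F x (F' x)) ->
  pd i (fun q => F (fst q)) p = delta i iu * F' (fst p).
Proof.
  intros H. apply is_derive_unique.
  apply (is_derive_along_coord F i iu p). apply H.
Qed.

Section Isothermal.

(* [l] is half the logarithmic derivative of the conformal factor.  In terms of
   it the Christoffel symbols are 0, [l] or [- l], and only [l'] enters the
   curvature. *)
Variables h l l' : R -> R.
Hypothesis h_pos : forall x, 0 < h x.
Hypothesis h_derive : forall x, is_derive h x (2 * l x * h x).
Hypothesis l_derive : forall x, is_derive l x (l' x).

Lemma pd_isothermal k i j p :
  pd k (isothermal h i j) p = delta k iu * delta i j * (2 * l (fst p) * h (fst p)).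
Proof.
  replace (isothermal h i j) with (fun q : R * R => delta i j * h (fst q)).
  - rewrite (pd_fst k (fun x => delta i j * h x)
               (fun x => delta i j * (2 * l x * h x))); [ring|].
    intros x. apply @is_derive_scal, h_derive.
  - apply functional_extensionality; intros q.
    unfold isothermal, conformal, euclidean, delta; ring.
Qed.

Lemma inv_isothermal i j p : inv (isothermal h) i j p = delta i j / h (fst p).
Proof.
  specialize (h_pos (fst p)).
  unfold inv, det, isothermal, conformal; destruct i, j; simpl; field; lra.
Qed.

Lemma christoffel_isothermal k i j :
  christoffel (isothermal h) k i j =
  fun p => (delta i iu * delta j k + delta j iu * delta i k
            - delta k iu * delta i j) * l (fst p).
Proof.
  apply functional_extensionality; intros p.
  unfold christoffel, sum2. rewrite !inv_isothermal, !pd_isothermal.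
  specialize (h_pos (fst p)).
  destruct k, i, j; simpl; field; lra.
Qed.

Lemma gauss_curvature_isothermal p :
  gauss_curvature (isothermal h) p = - l' (fst p) / h (fst p).
Proof.
  unfold gauss_curvature, riemann, sum2. rewrite !christoffel_isothermal.
  assert (D : forall k c, pd k (fun q => c * l (fst q)) p
                        = delta k iu * (c * l' (fst p))).
  { intros k c; rewrite (pd_fst k (fun x => c * l x) (fun x => c * l' x)); auto.
    intros x; apply @is_derive_scal, l_derive. }
  rewrite !D. specialize (h_pos (fst p)).
  unfold det, isothermal, conformal; simpl; field; lra.
Qed.

Lemma grad_isothermal (F F' : R -> R) i p :
  (forall x, is_derive F x (F' x)) ->
  grad (isothermal h) (fun q => F (fst q)) i p
    = delta i iu * F' (fst p) / h (fst p).
Proof.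
  intros HF. unfold grad, sum2.
  rewrite !inv_isothermal, !(pd_fst _ F F' p HF).
  specialize (h_pos (fst p)); destruct i; simpl; field; lra.
Qed.

(** In dimension two the factor [sqrt det = h] cancels the factor [1 / h] of the
    gradient, so the divergence is that of the flat gradient divided by [h]. *)
Lemma laplace_isothermal (F F' F'' : R -> R) p :
  (forall x, is_derive F x (F' x)) -> (forall x, is_derive F' x (F'' x)) ->
  laplace (isothermal h) (fun q => F (fst q)) p = - (F'' (fst p) / h (fst p)).
Proof.
  intros HF HF'.
  assert (Hd : forall q, sqrt (det (isothermal h) q) = h (fst q)).
  { intros q; specialize (h_pos (fst q)).
    replace (det (isothermal h) q) with (h (fst q) * h (fst q)).
    - apply sqrt_square; lra.
    - unfold det, isothermal, conformal; simpl; ring. }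
  assert (E : forall i, (fun q => sqrt (det (isothermal h) q)
      * grad (isothermal h) (fun q => F (fst q)) i q)
      = (fun q => delta i iu * F' (fst q))).
  { intros i; apply functional_extensionality; intros q.
    rewrite Hd, (grad_isothermal F F' i q HF).
    specialize (h_pos (fst q)); field; lra. }
  unfold laplace, div, sum2. rewrite !E, Hd.
  assert (D : forall i, pd i (fun q => delta i iu * F' (fst q)) p
                      = delta i iu * (delta i iu * F'' (fst p))).
  { intros i; apply (pd_fst i (fun x => delta i iu * F' x)
                              (fun x => delta i iu * F'' x)).
    intros x; apply @is_derive_scal, HF'. }
  rewrite !D.
  specialize (h_pos (fst p)); simpl; field; lra.
Qed.

Lemma norm_sq_grad_isothermal (F F' : R -> R) p :
  (forall x, is_derive F x (F' x)) ->
  norm_sq (isothermal h) (grad (isothermal h) (fun q => F (fst q))) p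
    = F' (fst p) ^ 2 / h (fst p).
Proof.
  intros HF. unfold norm_sq, sum2.
  rewrite !(grad_isothermal F F' _ p HF).
  specialize (h_pos (fst p)).
  unfold isothermal, conformal; simpl; field; lra.
Qed.

End Isothermal.

(** * The rescaled metric and the Ricci condition *)

Definition cosh2_metric (A : R) : metric := isothermal (fun x => A * cosh x ^ 2).

Lemma tanh_derive x : is_derive (fun t => sinh t / cosh t) x (/ cosh x ^ 2).
Proof.
  assert (H := cosh_pos x). auto_derive; [lra|].
  replace (/ cosh x ^ 2)
    with ((cosh x ^ 2 - sinh x ^ 2) / cosh x ^ 2) by (rewrite cosh_sq at 1; field; lra).
  field; lra.
Qed.

(** The power is written [2 * n] because half of the logarithmic derivative,
    [n * tanh], then has an integer coefficient; [n = 3] is the original metric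
    and [n = 1] the rescaled one. *)
Lemma gauss_curvature_cosh_pow C n p : 0 < C ->
  gauss_curvature (isothermal (fun x => C * cosh x ^ (2 * n))) p
    = - (INR n / (C * cosh (fst p) ^ (2 * n + 2))).
Proof.
  intros HC. assert (H := cosh_pos (fst p)).
  rewrite (gauss_curvature_isothermal _
             (fun x => INR n * (sinh x / cosh x)) (fun x => INR n * / cosh x ^ 2)).
  - rewrite pow_add. field. repeat split; try apply pow_nonzero; lra.
  - intros x; apply Rmult_lt_0_compat; [lra|apply pow_lt, cosh_pos].
  - intros x; assert (Hx := cosh_pos x). auto_derive; auto.
    destruct n as [|n]; [simpl; field; lra|].
    change (S n + (S n + 0))%nat with (2 * S n)%nat.
    replace (2 * S n)%nat with (S (S (2 * n))) by lia.
    rewrite !S_INR, mult_INR; simpl; field; lra.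
  - intros x; apply @is_derive_scal, tanh_derive.
Qed.

Lemma curvature_rescaled_cosh_metric C0 : 0 < C0 ->
  curvature_rescaled (cosh_metric C0) = cosh2_metric (sqrt (3 * C0)).
Proof.
  intros HC. do 3 (apply functional_extensionality; intro).
  rename x into i, x0 into j, x1 into p.
  assert (H := cosh_pos (fst p)).
  unfold curvature_rescaled, cosh2_metric, isothermal, conformal.
  change (gauss_curvature (cosh_metric C0)) with
    (gauss_curvature (isothermal (fun x => C0 * cosh x ^ (2 * 3)))).
  rewrite gauss_curvature_cosh_pow, Ropp_involutive by assumption.
  unfold cosh_metric, conformal. rewrite <- Rmult_assoc. f_equal.
  (* - K is written as a multiple of a square so that its root is explicit. *)
  replace (INR 3 / (C0 * cosh (fst p) ^ (2 * 3 + 2)))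
    with (3 * C0 * (/ (C0 * cosh (fst p) ^ 4)) ^ 2)
    by (simpl; field; lra).
  assert (0 < / (C0 * cosh (fst p) ^ 4)).
  { apply Rinv_0_lt_compat, Rmult_lt_0_compat; [lra|now apply pow_lt]. }
  rewrite sqrt_mult, sqrt_pow2 by nra. field; lra.
Qed.

Lemma ricci_condition_cosh2 A : 0 < A -> ricci_condition (cosh2_metric A).
Proof.
  intros HA p.
  assert (Acn : forall n x, 0 < A * cosh x ^ n)
    by (intros n x; apply Rmult_lt_0_compat; [lra|apply pow_lt, cosh_pos]).
  assert (Ac := Acn 2%nat).
  (* [F] is the curvature as a function of [u].  With [F''] reduced by
     cosh^2 - sinh^2 = 1, the Ricci condition needs no hyperbolic identity. *)
  set (F := fun x => - (1 / (A * cosh x ^ 4))).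
  set (F' := fun x => 4 * sinh x / (A * cosh x ^ 5)).
  set (F'' := fun x => (4 - 16 * sinh x ^ 2) / (A * cosh x ^ 6)).
  assert (HK : gauss_curvature (cosh2_metric A) = fun q => F (fst q)).
  { apply functional_extensionality; intros q.
    exact (gauss_curvature_cosh_pow A 1 q HA). }
  assert (HF : forall x, is_derive F x (F' x)).
  { intros x; assert (Hx := cosh_pos x); unfold F, F'; auto_derive.
    - exact (Rgt_not_eq _ _ (Acn 4%nat x)).
    - field; lra. }
  assert (HF' : forall x, is_derive F' x (F'' x)).
  { intros x; assert (Hx := cosh_pos x); unfold F', F''; auto_derive.
    - exact (Rgt_not_eq _ _ (Acn 5%nat x)).
    - transitivity ((4 * cosh x ^ 2 - 20 * sinh x ^ 2) / (A * cosh x ^ 6)).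
      + field; lra.
      + rewrite cosh_sq at 1. field; lra. }
  rewrite HK. unfold cosh2_metric.
  rewrite (laplace_isothermal _ Ac F F' F'' p HF HF').
  rewrite (norm_sq_grad_isothermal _ Ac F F' p HF).
  assert (Hx := cosh_pos (fst p)).
  unfold F, F', F''; split.
  - assert (0 < 1 / (A * cosh (fst p) ^ 4)); [|lra].
    apply Rdiv_lt_0_compat; [lra|apply Acn].
  - field; lra.
Qed.

(** * Completeness *)

Definition quad (g : metric) (p : R * R) (x : idx -> R) : R :=
  sum2 (fun i => sum2 (fun j => g i j p * x i * x j)).

Definition velocity (c : R -> R * R) (t : R) (i : idx) : R :=
  Derive (fun s => coord i (c s)) t.

Lemma continuous_pair (a b : R -> R) t :
  continuous a t -> continuous b t -> continuous (fun s => (a s, b s)) t.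
Proof.
  intros Ha Hb.
  apply (continuous_comp_2 a b (fun x y => (x, y)) t Ha Hb).
  intros P [e He]; exists e; intros q Hq; apply He; exact Hq.
Qed.

Lemma continuous_speed g c t :
  (forall i j p, continuous (g i j) p) -> C1_curve c ->
  continuous (fun s => sqrt (quad g (c s) (velocity c s))) t.
Proof.
  intros Hg Hc. apply continuous_sqrt_comp.
  assert (Cc : continuous c t).
  { apply continuous_ext with (fun s => (coord iu (c s), coord iv (c s))).
    - intros s; now destruct (c s).
    - apply continuous_pair; apply @ex_derive_continuous, Hc. }
  unfold quad, sum2, velocity.
  assert (T : forall i j, continuous (fun s => g i j (c s)
      * Derive (fun r => coord i (c r)) s * Derive (fun r => coord j (c r)) s) t).
  { intros i j. apply @continuous_mult; [apply @continuous_mult|].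
    - apply (continuous_comp c (g i j)); auto.
    - apply Hc.
    - apply Hc. }
  apply @continuous_plus; apply @continuous_plus; apply T.
Qed.

(** The displacement of a coordinate is the integral of its velocity, and [m]
    times the velocity is at most the speed for [g]. *)
Lemma le_length g m c i :
  0 <= m -> (forall i j p, continuous (g i j) p) ->
  (forall p x, m ^ 2 * sum2 (fun i => x i ^ 2) <= quad g p x) ->
  C1_curve c -> m * Rabs (coord i (c 1) - coord i (c 0)) <= length g c.
Proof.
  intros Hm Hg Hle Hc.
  assert (ID : ex_RInt (fun s => velocity c s i) 0 1).
  { apply @ex_RInt_continuous; intros t _; apply Hc. }
  assert (E : RInt (fun s => velocity c s i) 0 1
              = coord i (c 1) - coord i (c 0)).
  { apply (RInt_Derive (fun s => coord i (c s))); intros; apply Hc. }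
  rewrite <- E, <- (Rabs_pos_eq m Hm), <- Rabs_mult.
  replace (m * RInt (fun s => velocity c s i) 0 1)
    with (RInt (fun s => m * velocity c s i) 0 1)
    by exact (@RInt_scal R_CompleteNormedModule _ 0 1 m ID).
  apply Rle_trans with (RInt (fun s => Rabs (m * velocity c s i)) 0 1).
  - apply abs_RInt_le; [lra|]. exact (@ex_RInt_scal R_NormedModule _ 0 1 m ID).
  - apply RInt_le; [lra| | |].
    + apply @ex_RInt_continuous; intros t _.
      apply continuous_Rabs_comp. apply (continuous_scal_r m (fun s => velocity c s i)).
      apply Hc.
    + apply @ex_RInt_continuous; intros t _. now apply (continuous_speed g c).
    + intros t _. rewrite <- sqrt_Rsqr_abs. apply sqrt_le_1_alt.
      refine (Rle_trans _ _ _ _ (Hle (c t) (velocity c t))).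
      unfold sum2, Rsqr; destruct i;
        assert (0 <= (m * velocity c t iu) ^ 2) by apply pow2_ge_0;
        assert (0 <= (m * velocity c t iv) ^ 2) by apply pow2_ge_0; lra.
Qed.

Lemma le_pw_C1_length g m i p q l :
  0 <= m -> (forall i j p, continuous (g i j) p) ->
  (forall p x, m ^ 2 * sum2 (fun i => x i ^ 2) <= quad g p x) ->
  pw_C1_length g p q l -> m * Rabs (coord i p - coord i q) <= l.
Proof.
  intros Hm Hg Hle H; induction H as [p|c q l Hc _ IH].
  - rewrite Rminus_diag, Rabs_R0; lra.
  - assert (B := le_length g m c i Hm Hg Hle Hc).
    assert (T := Rabs_triang (coord i (c 0) - coord i (c 1))
                             (coord i (c 1) - coord i q)).
    rewrite (Rabs_minus_sym (coord i (c 0)) (coord i (c 1))) in T.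
    replace (coord i (c 0) - coord i (c 1) + (coord i (c 1) - coord i q))
      with (coord i (c 0) - coord i q) in T by ring.
    nra.
Qed.

Definition segment (p q : R * R) (t : R) : R * R :=
  (fst p + t * (fst q - fst p), snd p + t * (snd q - snd p)).

Lemma is_derive_segment p q i t :
  is_derive (fun s => coord i (segment p q s)) t (coord i q - coord i p).
Proof. destruct i; simpl; auto_derive; auto; ring. Qed.

Lemma C1_segment p q : C1_curve (segment p q).
Proof.
  intros i t; split.
  - eexists; apply is_derive_segment.
  - apply continuous_ext with (fun _ => coord i q - coord i p).
    + intros s; symmetry; apply is_derive_unique, is_derive_segment.
    + apply continuous_const.
Qed.

Lemma pw_C1_length_segment g p q :
  pw_C1_length g p q (length g (segment p q)).
Proof.
  rewrite <- Rplus_0_r.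
  replace p with (segment p q 0) at 1
    by (destruct p, q; unfold segment; simpl; f_equal; ring).
  apply pw_cons; [apply C1_segment|].
  replace (segment p q 1) with q
    by (destruct p, q; unfold segment; simpl; f_equal; ring).
  apply pw_nil.
Qed.

(** [real] sends infinities to 0, so the comparison of [dist] with a bound needs
    the greatest lower bound to be finite: it is, the set of lengths being
    nonempty and bounded below. *)
Lemma dist_le g p q l :
  (forall l, pw_C1_length g p q l -> 0 <= l) ->
  pw_C1_length g p q l -> Defs.dist g p q <= l.
Proof.
  intros H0 Hl. unfold Defs.dist.
  destruct (Glb_Rbar_correct (pw_C1_length g p q)) as [H1 H2].
  assert (U : Rbar_le (Glb_Rbar (pw_C1_length g p q)) l) by now apply H1.
  assert (L : Rbar_le 0 (Glb_Rbar (pw_C1_length g p q)))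
    by (apply H2; intros x Hx; now apply H0).
  destruct (Glb_Rbar (pw_C1_length g p q)); simpl in *; tauto || lra.
Qed.

(** Here the set of lengths is nonempty thanks to the straight segment. *)
Lemma le_dist g p q b :
  (forall l, pw_C1_length g p q l -> b <= l) -> b <= Defs.dist g p q.
Proof.
  intros Hb. unfold Defs.dist.
  destruct (Glb_Rbar_correct (pw_C1_length g p q)) as [H1 H2].
  assert (U := H1 _ (pw_C1_length_segment g p q)).
  assert (L : Rbar_le b (Glb_Rbar (pw_C1_length g p q)))
    by (apply H2; intros x Hx; now apply Hb).
  destruct (Glb_Rbar (pw_C1_length g p q)); simpl in *; tauto || lra.
Qed.

Lemma locally_bounded (g : metric) (p : R * R) :
  (forall i j, continuous (g i j) p) ->
  exists M r, 0 <= M /\ 0 < r /\ forall q,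
    (forall i, Rabs (coord i q - coord i p) < r) ->
    forall i j, Rabs (g i j q) <= M.
Proof.
  intros Hg.
  assert (B : forall i j, locally p (fun q => Rabs (g i j q - g i j p) < 1)).
  { intros i j. apply (Hg i j (fun y => Rabs (y - g i j p) < 1)).
    exists (mkposreal 1 Rlt_0_1). now intros y Hy. }
  destruct (filter_and _ _ (filter_and _ _ (B iu iu) (B iu iv))
                           (filter_and _ _ (B iv iu) (B iv iv))) as [r Hr].
  exists (1 + Rabs (g iu iu p) + Rabs (g iu iv p)
            + Rabs (g iv iu p) + Rabs (g iv iv p)), r.
  assert (A1 := Rabs_pos (g iu iu p)); assert (A2 := Rabs_pos (g iu iv p)).
  assert (A3 := Rabs_pos (g iv iu p)); assert (A4 := Rabs_pos (g iv iv p)).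
  split; [lra|split; [apply cond_pos|]]. intros q Hq i j.
  assert (Q : ball p r q) by (split; [apply (Hq iu)|apply (Hq iv)]).
  specialize (Hr q Q). simpl in Hr.
  assert (T := Rabs_triang (g i j q - g i j p) (g i j p)).
  replace (g i j q - g i j p + g i j p) with (g i j q) in T by ring.
  destruct i, j; lra.
Qed.

(** If all coefficients are at most [M] in absolute value, the quadratic form is
    at most [M] times the square of the l^1 norm. *)
Lemma length_segment_le (g : metric) M p q :
  (forall i j p, continuous (g i j) p) -> 0 <= M ->
  (forall t, 0 <= t <= 1 -> forall i j, Rabs (g i j (segment q p t)) <= M) ->
  length g (segment q p)
    <= sqrt M * sum2 (fun i => Rabs (coord i q - coord i p)).
Proof.
  intros Hg HM HB. set (D := sum2 _).
  assert (HD : 0 <= D)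
    by (apply Rplus_le_le_0_compat; apply Rabs_pos).
  replace (sqrt M * D) with (RInt (fun _ => sqrt M * D) 0 1)
    by (rewrite RInt_const; unfold scal; simpl; unfold mult; simpl; ring).
  apply RInt_le; [lra| | |].
  - apply @ex_RInt_continuous; intros t _.
    now apply (continuous_speed g (segment q p) t Hg), C1_segment.
  - apply ex_RInt_const.
  - intros t Ht.
    rewrite <- (sqrt_pow2 D HD), <- sqrt_mult by (trivial; apply pow2_ge_0).
    apply sqrt_le_1_alt.
    assert (T : forall i j, g i j (segment q p t)
       * Derive (fun s => coord i (segment q p s)) t
       * Derive (fun s => coord j (segment q p s)) t
       <= M * Rabs (coord i q - coord i p) * Rabs (coord j q - coord j p)).
    { intros i j.
      rewrite !(is_derive_unique _ _ _ (is_derive_segment q p _ t)).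
      eapply Rle_trans; [apply Rle_abs|]. rewrite !Rabs_mult.
      rewrite (Rabs_minus_sym (coord i p)), (Rabs_minus_sym (coord j p)).
      apply Rmult_le_compat_r; [apply Rabs_pos|].
      apply Rmult_le_compat_r; [apply Rabs_pos|]. apply HB; lra. }
    assert (T1 := T iu iu); assert (T2 := T iu iv).
    assert (T3 := T iv iu); assert (T4 := T iv iv).
    unfold D, sum2. lra.
Qed.

(** A metric dominating a positive multiple of the Euclidean one has no more
    Cauchy sequences than the plane; continuity of the coefficients makes
    Euclidean convergence imply convergence for its distance. *)
Lemma complete_of_ge_euclidean (g : metric) m :
  0 < m -> (forall i j p, continuous (g i j) p) ->
  (forall p x, m ^ 2 * sum2 (fun i => x i ^ 2) <= quad g p x) -> complete g.
Proof.
  intros Hm Hg Hle s Cs.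
  assert (LB : forall i p q l, pw_C1_length g p q l ->
            m * Rabs (coord i p - coord i q) <= l)
    by (intros; apply (le_pw_C1_length g m); auto; lra).
  assert (L0 : forall p q l, pw_C1_length g p q l -> 0 <= l).
  { intros p q l H; apply (LB iu) in H.
    assert (P := Rabs_pos (coord iu p - coord iu q)); nra. }
  assert (CV : forall i, exists x, Un_cv (fun n => coord i (s n)) x).
  { intros i.
    assert (CC : Cauchy_crit (fun n => coord i (s n))).
    { intros e He. destruct (Cs (m * e)) as [N HN]; [nra|].
      exists N; intros a b Ha Hb.
      assert (B := le_dist g (s a) (s b) _ (LB i (s a) (s b))).
      specialize (HN a b Ha Hb). unfold Rdist. nra. }
    destruct (Rcomplete.R_complete _ CC) as [x Hx]; now exists x. }
  destruct (CV iu) as [x Hx], (CV iv) as [y Hy].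
  exists (x, y). intros e He.
  destruct (locally_bounded g (x, y)) as [M [r [HM [Hr HB]]]]; [auto|].
  (* Coordinates within [r] of the limit stay where [g] is bounded by [M]; within
     the second bound, the segment to the limit is shorter than [e]. *)
  set (d := Rmin r (e / (2 * (sqrt M + 1)))).
  assert (SM := sqrt_pos M).
  assert (Hd : 0 < d) by (apply Rmin_pos; [lra|apply Rdiv_lt_0_compat; lra]).
  destruct (Hx d Hd) as [N1 H1], (Hy d Hd) as [N2 H2].
  exists (Nat.max N1 N2). intros n Hn.
  assert (HC : forall i, Rabs (coord i (s n) - coord i (x, y)) < d).
  { intros []; [apply H1|apply H2]; lia. }
  eapply Rle_lt_trans.
  - apply dist_le; [apply L0|apply pw_C1_length_segment].
  - eapply Rle_lt_trans.
    + apply length_segment_le with (M := M); auto.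
      intros t Ht. apply HB. intros i.
      assert (Hi := HC i).
      replace (coord i (segment (s n) (x, y) t) - coord i (x, y))
        with ((1 - t) * (coord i (s n) - coord i (x, y)))
        by (destruct i; simpl; ring).
      rewrite Rabs_mult, (Rabs_pos_eq (1 - t)) by lra.
      assert (P := Rabs_pos (coord i (s n) - coord i (x, y))).
      assert (Q : d <= r) by apply Rmin_l. nra.
    + assert (Q : d <= e / (2 * (sqrt M + 1))) by apply Rmin_r.
      assert (E : e / (2 * (sqrt M + 1)) * (2 * (sqrt M + 1)) = e) by (field; lra).
      assert (Hu := HC iu); assert (Hv := HC iv). unfold sum2. nra.
Qed.

Lemma elementary_cosh2 A : elementary (fun p => A * cosh (fst p) ^ 2).
Proof.
  exact (el_mult _ _ (el_const A)
    (el_mult _ _ (el_cosh iu) (el_mult _ _ (el_cosh iu) (el_const 1)))).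
Qed.

Lemma complete_cosh2 A : 0 < A -> complete (cosh2_metric A).
Proof.
  intros HA. apply (complete_of_ge_euclidean _ (sqrt A)).
  - now apply sqrt_lt_R0.
  - intros i j; apply elementary_continuous.
    apply el_mult; [apply elementary_cosh2|].
    destruct i, j; solve [exact (el_const 1) | exact (el_const 0)].
  - intros p x. rewrite pow2_sqrt by lra.
    unfold quad, cosh2_metric, isothermal, conformal, sum2; simpl.
    assert (Q := cosh_sq (fst p)); simpl in Q.
    assert (0 <= sinh (fst p) ^ 2) by apply pow2_ge_0.
    assert (0 <= A * (x iu ^ 2 + x iv ^ 2) * sinh (fst p) ^ 2).
    { apply Rmult_le_pos; [apply Rmult_le_pos; [lra|]|assumption].
      apply Rplus_le_le_0_compat; apply pow2_ge_0. }
    simpl in *; rewrite Q; lra.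
Qed.

(** * Minimal immersions *)

(** In isothermal coordinates the mean curvature is the normal component of the
    flat Laplacian of the position, up to a factor, so it vanishes when the
    coordinate functions are harmonic.  The cross product of the tangent vectors
    is nonzero by Lagrange's identity: its square is the determinant [h ^ 2] of
    the first fundamental form. *)
Lemma isometric_minimal_of_harmonic (h : R * R -> R) X :
  smooth3 X -> (forall p, 0 < h p) ->
  isometric (conformal h euclidean) X ->
  (forall p, pd3 iv (pd3 iv X) p = scale3 (-1) (pd3 iu (pd3 iu X) p)) ->
  isometric_minimal_immersion (conformal h euclidean) X.
Proof.
  intros SX Hh HI HH. split; [split; [exact SX|]|split; [exact HI|]].
  - intros p E.
    assert (Iuu := HI iu iu p); assert (Iuv := HI iu iv p);
      assert (Ivv := HI iv iv p); specialize (Hh p).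
    unfold first_form, conformal in Iuu, Iuv, Ivv.
    destruct (pd3 iu X p) as [[a1 a2] a3], (pd3 iv X p) as [[b1 b2] b3].
    simpl in *. injection E as E1 E2 E3.
    assert (L : (a2 * b3 - a3 * b2) ^ 2 + (a3 * b1 - a1 * b3) ^ 2
                + (a1 * b2 - a2 * b1) ^ 2
                = (a1 * a1 + a2 * a2 + a3 * a3) * (b1 * b1 + b2 * b2 + b3 * b3)
                  - (a1 * b1 + a2 * b2 + a3 * b3) ^ 2) by ring.
    rewrite E1, E2, E3, Iuu, Iuv, Ivv in L. nra.
  - intros p. unfold mean_curvature, sum2, inv, det.
    rewrite !HI. specialize (Hh p).
    assert (S : second_form X iv iv p = - second_form X iu iu p).
    { unfold second_form; rewrite HH.
      destruct (pd3 iu (pd3 iu X) p) as [[a1 a2] a3],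
               (unit_normal X p) as [[n1 n2] n3]; simpl; ring. }
    rewrite S. unfold conformal; simpl. field; lra.
Qed.

Definition catenoid_map (c : R) (p : R * R) : vec3 :=
  (c * cosh (fst p) * cos (snd p), c * cosh (fst p) * sin (snd p), c * fst p).

Definition helicoid_map (c : R) (p : R * R) : vec3 :=
  (c * sinh (fst p) * cos (snd p), c * sinh (fst p) * sin (snd p), c * snd p).

Ltac compute_pd3 :=
  apply functional_extensionality; intros p; unfold pd3, pd; simpl;
  f_equal; [f_equal|]; apply is_derive_unique; auto_derive; auto; ring.

Lemma pd3_u_catenoid c : pd3 iu (catenoid_map c) = fun p =>
  (c * sinh (fst p) * cos (snd p), c * sinh (fst p) * sin (snd p), c).
Proof. compute_pd3. Qed.

Lemma pd3_v_catenoid c : pd3 iv (catenoid_map c) = fun p =>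
  (- (c * cosh (fst p) * sin (snd p)), c * cosh (fst p) * cos (snd p), 0).
Proof. compute_pd3. Qed.

Lemma pd3_u_helicoid c : pd3 iu (helicoid_map c) = fun p =>
  (c * cosh (fst p) * cos (snd p), c * cosh (fst p) * sin (snd p), 0).
Proof. compute_pd3. Qed.

Lemma pd3_v_helicoid c : pd3 iv (helicoid_map c) = fun p =>
  (- (c * sinh (fst p) * sin (snd p)), c * sinh (fst p) * cos (snd p), c).
Proof. compute_pd3. Qed.

Lemma pd3_eq i X p l1 l2 l3 :
  is_derive (fun t => fst (fst (X (subst_coord i p t)))) (coord i p) l1 ->
  is_derive (fun t => snd (fst (X (subst_coord i p t)))) (coord i p) l2 ->
  is_derive (fun t => snd (X (subst_coord i p t))) (coord i p) l3 ->
  pd3 i X p = (l1, l2, l3).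
Proof.
  intros H1 H2 H3; unfold pd3, pd.
  apply (f_equal2 pair); [apply (f_equal2 pair)|]; now apply is_derive_unique.
Qed.

Lemma cos_sq v : cos v ^ 2 = 1 - sin v ^ 2.
Proof. generalize (sin2_cos2 v); unfold Rsqr; lra. Qed.

Lemma catenoid_minimal A : 0 < A ->
  isometric_minimal_immersion (cosh2_metric A) (catenoid_map (sqrt A)).
Proof.
  intros HA. assert (HS := pow2_sqrt A (Rlt_le _ _ HA)). set (c := sqrt A) in *.
  apply isometric_minimal_of_harmonic.
  - split; [|split]; apply smooth_elementary.
    + exact (el_mult _ _ (el_mult _ _ (el_const c) (el_cosh iu)) (el_cos iv)).
    + exact (el_mult _ _ (el_mult _ _ (el_const c) (el_cosh iu)) (el_sin iv)).
    + exact (el_mult _ _ (el_const c) (el_coord iu)).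
  - intros p; apply Rmult_lt_0_compat; [exact HA|apply pow_lt, cosh_pos].
  - intros i j p. unfold first_form, conformal. rewrite <- HS, cosh_sq.
    assert (Hc := cos_sq (snd p)). assert (Hh := cosh_sq (fst p)).
    destruct i, j; rewrite ?pd3_u_catenoid, ?pd3_v_catenoid; simpl; ring [Hc Hh].
  - intros p. rewrite pd3_u_catenoid, pd3_v_catenoid.
    erewrite !pd3_eq by (simpl; auto_derive; [auto|reflexivity]).
    simpl; f_equal; [f_equal|]; ring.
Qed.

Lemma helicoid_minimal A : 0 < A ->
  isometric_minimal_immersion (cosh2_metric A) (helicoid_map (sqrt A)).
Proof.
  intros HA. assert (HS := pow2_sqrt A (Rlt_le _ _ HA)). set (c := sqrt A) in *.
  apply isometric_minimal_of_harmonic.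
  - split; [|split]; apply smooth_elementary.
    + exact (el_mult _ _ (el_mult _ _ (el_const c) (el_sinh iu)) (el_cos iv)).
    + exact (el_mult _ _ (el_mult _ _ (el_const c) (el_sinh iu)) (el_sin iv)).
    + exact (el_mult _ _ (el_const c) (el_coord iv)).
  - intros p; apply Rmult_lt_0_compat; [exact HA|apply pow_lt, cosh_pos].
  - intros i j p. unfold first_form, conformal. rewrite <- HS, cosh_sq.
    assert (Hc := cos_sq (snd p)). assert (Hh := cosh_sq (fst p)).
    destruct i, j; rewrite ?pd3_u_helicoid, ?pd3_v_helicoid; simpl; ring [Hc Hh].
  - intros p. rewrite pd3_u_helicoid, pd3_v_helicoid.
    erewrite !pd3_eq by (simpl; auto_derive; [auto|reflexivity]).
    simpl; f_equal; [f_equal|]; ring.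
Qed.

Lemma congruent_of_same_points (S T : vec3 -> Prop) :
  (forall q, S q <-> T q) -> congruent S T.
Proof.
  intros H. exists (fun q => q); split; [now intros a b|intros q; split].
  - intros Hq; exists q; split; [now apply H|reflexivity].
  - intros [a [Ha <-]]; now apply H.
Qed.

Lemma image_catenoid c : 0 < c -> is_catenoid (image (catenoid_map c)).
Proof.
  intros Hc; exists c; split; [exact Hc|].
  apply congruent_of_same_points; intros q; split; intros [[a b] <-].
  - exists (a / c, b). unfold catenoid_map; simpl. f_equal; field; lra.
  - exists (c * a, b). unfold catenoid_map; simpl.
    now replace (c * a / c) with a by (field; lra).
Qed.

Lemma image_helicoid c : 0 < c -> is_helicoid (image (helicoid_map c)).
Proof.
  intros Hc; exists c; split; [lra|].
  apply congruent_of_same_points; intros q; split; intros [[a b] <-].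
  - exists (arcsinh (a / c), b). unfold helicoid_map; simpl.
    rewrite sinh_arcsinh. now replace (c * (a / c)) with a by (field; lra).
  - now exists (c * sinh a, b).
Qed.

Theorem theorem4p8 (C0 : R) (hC0 : 0 < C0) :
  riemannian (curvature_rescaled (cosh_metric C0)) /\
  complete (curvature_rescaled (cosh_metric C0)) /\
  ricci_condition (curvature_rescaled (cosh_metric C0)) /\
  (exists X : R * R -> vec3,
     isometric_minimal_immersion (curvature_rescaled (cosh_metric C0)) X /\
     is_helicoid (image X)) /\
  (exists X : R * R -> vec3,
     isometric_minimal_immersion (curvature_rescaled (cosh_metric C0)) X /\
     is_catenoid (image X)).
Proof.
  rewrite (curvature_rescaled_cosh_metric C0 hC0).
  assert (HA : 0 < sqrt (3 * C0)) by (apply sqrt_lt_R0; lra).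
  set (A := sqrt (3 * C0)) in *.
  assert (Hc : 0 < sqrt A) by now apply sqrt_lt_R0.
  split; [|split; [|split; [|split]]].
  - apply riemannian_isothermal.
    + apply smooth_elementary, elementary_cosh2.
    + intros x; apply Rmult_lt_0_compat; [exact HA|apply pow_lt, cosh_pos].
  - now apply complete_cosh2.
  - now apply ricci_condition_cosh2.
  - exists (helicoid_map (sqrt A)); split;
      [now apply helicoid_minimal|now apply image_helicoid].
  - exists (catenoid_map (sqrt A)); split;
      [now apply catenoid_minimal|now apply image_catenoid].
Qed.
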